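(* Let $F$ be a field and let $\mathcal A$ be one of the categories $\mathbf{GrAlg}_F$, $\mathbf{GrAlg}^1_F$. Let $A$ and $B$ be objects of $\mathcal A$. Then a (categorical) product of $A$ and $B$ in $\mathcal A$ exists if and only if at least one of $A$ and $B$ is the zero algebra or both $A$ and $B$ are algebras with a trivial grading.
   Context: Algebras are associative over the field $F$, not necessarily unital or commutative. A grading on an algebra $A$ by a group $G$ is a decomposition $\Gamma\colon A=\bigoplus_{g\in G}A^{(g)}$ into a direct sum of subspaces with $A^{(g)}A^{(h)}\subseteq A^{(gh)}$ for all $g,h\in G$; its support is $\{g\in G\mid A^{(g)}\neq 0\}$. A grading is called trivial if all of $A$ is concentrated in one graded component, i.e. the support has at most one element. A homomorphism of algebras $\psi\colon A\to B$ between graded algebras $A=\bigoplus_{g\in G}A^{(g)}$ and $B=\bigoplus_{h\in H}B^{(h)}$ (where $G$ and $H$ may be different groups) is graded if for every $g\in G$ there exists $h\in H$ with $\psi(A^{(g)})\subseteq B^{(h)}$. $\mathbf{GrAlg}_F$ is the category whose objects are all gradings by arbitrary groups on (not necessarily unital) associative $F$-algebras and whose morphisms are the graded homomorphisms. $\mathbf{GrAlg}^1_F$ is the category whose objects are all group gradings on unital associative $F$-algebras (the zero algebra included) and whose morphisms are the unital graded homomorphisms. A graded algebra is identified with the grading on it. *)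

(* Defs.v *)
(* Proof irrelevance and extensionality (boolp) give equality of morphisms. *)
From HB Require Import structures.
From mathcomp Require Import all_boot all_order all_algebra.
From mathcomp Require Import boolp.
Set Implicit Arguments.
Unset Strict Implicit.
Unset Printing Implicit Defensive.
Import GRing.Theory.
Local Open Scope ring_scope.

(* The ring and algebra structures of ssralg are unital, and [algType] moreover
   requires 1 != 0; hence these structures, which allow the zero algebra. *)
HB.mixin Record Lmodule_isAssocAlg (F : fieldType) A of GRing.Lmodule F A := {
  amul : A -> A -> A;
  amulA : associative amul;
  amulDl : left_distributive amul +%R;
  amulDr : right_distributive amul +%R;
  ascalerAl : forall (k : F) (x y : A), k *: amul x y = amul (k *: x) y;
  ascalerAr : forall (k : F) (x y : A), k *: amul x y = amul x (k *: y)
}.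

#[short(type="assocAlgType")]
HB.structure Definition AssocAlg (F : fieldType) :=
  {A of Lmodule_isAssocAlg F A & GRing.Lmodule F A}.

HB.mixin Record AssocAlg_isUnital (F : fieldType) A of AssocAlg F A := {
  aone : A;
  amul1r : left_id aone (@amul F A);
  amulr1 : right_id aone (@amul F A)
}.

#[short(type="unitalAssocAlgType")]
HB.structure Definition UnitalAssocAlg (F : fieldType) :=
  {A of AssocAlg_isUnital F A & AssocAlg F A}.

(* [groupType] is the type of arbitrary, possibly infinite, groups. The fields
   [homog_span] and [homog_free] say that A is the direct sum of the subspaces
   [homog g]. *)
Record grading (F : fieldType) (G : groupType) (A : assocAlgType F) := Grading {
  homog : G -> A -> Prop;
  homog0 : forall g, homog g 0;
  homogD : forall g a b, homog g a -> homog g b -> homog g (a + b);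
  homogZ : forall g (k : F) a, homog g a -> homog g (k *: a);
  homog_span : forall a, exists (s : seq G) (x : G -> A),
    [/\ uniq s, forall g, homog g (x g) & a = \sum_(g <- s) x g];
  homog_free : forall (s : seq G) (x : G -> A),
    uniq s -> (forall g, homog g (x g)) -> \sum_(g <- s) x g = 0 ->
    forall g, g \in s -> x g = 0;
  homogM : forall g h a b,
    homog g a -> homog h b -> homog (g * h)%g (amul a b)
}.

Record grAlg (F : fieldType) := GrAlg {
  gr_group : groupType;
  gr_alg :> assocAlgType F;
  gr_grading : grading gr_group gr_alg
}.

Record grAlg1 (F : fieldType) := GrAlg1 {
  gr1_group : groupType;
  gr1_alg :> unitalAssocAlgType F;
  gr1_grading : grading gr1_group gr1_alg
}.

Definition grAlg_of_grAlg1 (F : fieldType) (A : grAlg1 F) : grAlg F :=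
  GrAlg (gr1_grading A).
Coercion grAlg_of_grAlg1 : grAlg1 >-> grAlg.

Definition support (F : fieldType) (A : grAlg F) (g : gr_group A) : Prop :=
  exists a : A, homog (gr_grading A) g a /\ a <> 0.

Definition trivial_grading (F : fieldType) (A : grAlg F) : Prop :=
  forall g h : gr_group A, support g -> support h -> g = h.

Definition zero_algebra (F : fieldType) (A : grAlg F) : Prop :=
  forall a : A, a = 0.

Definition graded_map (F : fieldType) (A B : grAlg F) (f : A -> B) : Prop :=
  forall g : gr_group A, exists h : gr_group B,
    forall a, homog (gr_grading A) g a -> homog (gr_grading B) h (f a).

Definition graded_hom (F : fieldType) (A B : grAlg F) (f : A -> B) : Prop :=
  [/\ linear f, {morph f : a b / amul a b} & graded_map f].

Definition unital_graded_hom (F : fieldType) (A B : grAlg1 F) (f : A -> B) :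
    Prop :=
  @graded_hom F A B f /\ f aone = aone.

Record category := Category {
  obj :> Type;
  hom : obj -> obj -> Type;
  idm : forall X, hom X X;
  compm : forall X Y Z, hom Y Z -> hom X Y -> hom X Z;
  compm1 : forall X Y (f : hom X Y), compm f (idm X) = f;
  comp1m : forall X Y (f : hom X Y), compm (idm Y) f = f;
  compmA : forall X Y Z W (f : hom Z W) (g : hom Y Z) (h : hom X Y),
    compm f (compm g h) = compm (compm f g) h
}.

Definition is_product (C : category) (A B P : C)
    (pA : hom P A) (pB : hom P B) : Prop :=
  forall (X : C) (f : hom X A) (g : hom X B),
    exists! h : hom X P, compm pA h = f /\ compm pB h = g.

Definition has_product (C : category) (A B : C) : Prop :=
  exists (P : C) (pA : hom P A) (pB : hom P B), is_product pA pB.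

Section GrAlgCategory.
Variable F : fieldType.

Definition GrAlg_hom (A B : grAlg F) : Type := {f : A -> B | graded_hom f}.

Lemma graded_hom_id (A : grAlg F) : graded_hom (@id A).
Proof. by split=> // g; exists g. Qed.

Lemma graded_hom_comp (A B C : grAlg F) (f : B -> C) (g : A -> B) :
  graded_hom f -> graded_hom g -> graded_hom (f \o g).
Proof.
move=> [fl fM fG] [gl gM gG]; split.
- by move=> k a b /=; rewrite gl fl.
- by move=> a b /=; rewrite gM fM.
- move=> x; have [y gxy] := gG x; have [z fyz] := fG y.
  by exists z => a /gxy/fyz.
Qed.

Definition GrAlg_id (A : grAlg F) : GrAlg_hom A A := exist _ _ (graded_hom_id A).

Definition GrAlg_comp (A B C : grAlg F) (f : GrAlg_hom B C)
    (g : GrAlg_hom A B) : GrAlg_hom A C :=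
  exist _ _ (graded_hom_comp (svalP f) (svalP g)).

Fact GrAlg_comp1 (A B : grAlg F) (f : GrAlg_hom A B) :
  GrAlg_comp f (GrAlg_id A) = f.
Proof. by case: f => f fP; apply: eq_exist. Qed.

Fact GrAlg_1comp (A B : grAlg F) (f : GrAlg_hom A B) :
  GrAlg_comp (GrAlg_id B) f = f.
Proof. by case: f => f fP; apply: eq_exist. Qed.

Fact GrAlg_compA (A B C D : grAlg F) (f : GrAlg_hom C D) (g : GrAlg_hom B C)
    (h : GrAlg_hom A B) :
  GrAlg_comp f (GrAlg_comp g h) = GrAlg_comp (GrAlg_comp f g) h.
Proof. by apply: eq_exist. Qed.

Definition GrAlg_cat : category := Category GrAlg_comp1 GrAlg_1comp GrAlg_compA.

Definition GrAlg1_hom (A B : grAlg1 F) : Type :=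
  {f : A -> B | unital_graded_hom f}.

Lemma unital_graded_hom_id (A : grAlg1 F) : unital_graded_hom (@id A).
Proof. by split=> //; apply: graded_hom_id. Qed.

Lemma unital_graded_hom_comp (A B C : grAlg1 F) (f : B -> C) (g : A -> B) :
  unital_graded_hom f -> unital_graded_hom g -> unital_graded_hom (f \o g).
Proof.
move=> [fH f1] [gH g1]; split; last by rewrite /= g1 f1.
exact: (graded_hom_comp fH gH).
Qed.

Definition GrAlg1_id (A : grAlg1 F) : GrAlg1_hom A A :=
  exist _ _ (unital_graded_hom_id A).

Definition GrAlg1_comp (A B C : grAlg1 F) (f : GrAlg1_hom B C)
    (g : GrAlg1_hom A B) : GrAlg1_hom A C :=
  exist _ _ (unital_graded_hom_comp (svalP f) (svalP g)).

Fact GrAlg1_comp1 (A B : grAlg1 F) (f : GrAlg1_hom A B) :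
  GrAlg1_comp f (GrAlg1_id A) = f.
Proof. by case: f => f fP; apply: eq_exist. Qed.

Fact GrAlg1_1comp (A B : grAlg1 F) (f : GrAlg1_hom A B) :
  GrAlg1_comp (GrAlg1_id B) f = f.
Proof. by case: f => f fP; apply: eq_exist. Qed.

Fact GrAlg1_compA (A B C D : grAlg1 F) (f : GrAlg1_hom C D)
    (g : GrAlg1_hom B C) (h : GrAlg1_hom A B) :
  GrAlg1_comp f (GrAlg1_comp g h) = GrAlg1_comp (GrAlg1_comp f g) h.
Proof. by apply: eq_exist. Qed.

Definition GrAlg1_cat : category :=
  Category GrAlg1_comp1 GrAlg1_1comp GrAlg1_compA.

End GrAlgCategory.

(* Main.v *)
Require Import Defs.
From HB Require Import structures.
From mathcomp Require Import all_boot all_order all_algebra.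
From mathcomp Require Import boolp.

(** The zero algebra is a terminal object, so its product with any [A] is [A].
    If [A] and [B] are trivially graded, every homomorphism into them is graded,
    and the product algebra [A * B] with all elements in one degree is their
    product.

    Conversely, let [P] be a product of [A] and [B] with [B] nonzero, and fix a
    nonzero homogeneous [b] in [B]. The test object [T] is the direct product
    [xF[x] * yF[y]] of two copies of the algebra of polynomials without constant
    term, graded by degree over the group of integers; [x] and [y] lie in the same
    component. For each homogeneous [a] in [A], the maps [x |-> a, y |-> 0] into
    [A] and [x |-> 0, y |-> b] into [B] are graded, and lift to [h : T -> P].
    Precomposing [h] with the endomorphism that kills [x] gives the lift of
    [0] and [y |-> b], so [h y] is independent of [a] by uniqueness of lifts.
    It is nonzero since it projects to [b], hence lies in exactly one component
    of [P]. Then [h x] lies in that same component for every choice of [a], and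
    since the projection to [A] is graded and sends [h x] to [a], all homogeneous
    [a] lie in one component of [A] ([product_on_trivial]). Exchanging the roles
    of [A] and [B] gives the statement for [B].

    The unital case reduces to the same test object. Adjoining a unit to a graded
    algebra [X] that vanishes in the neutral degree puts [F] in that degree; a
    graded map from [X] to a unital [A] extends to a unital graded map, because
    the unit of [A] is homogeneous ([homog_aone]). So a product in the unital
    category still has the universal property for maps out of [T]
    ([GrAlg1_product_on]). *)

Set Implicit Arguments.
Unset Strict Implicit.
Unset Printing Implicit Defensive.
Import GRing.Theory.
Local Open Scope ring_scope.

(** * Multiplication and gradings *)

Section AssocAlgTheory.
Variables (F : fieldType) (A : assocAlgType F).
Implicit Types a b : A.

Lemma amul0r a : amul 0 a = 0.
Proof. by rewrite -[X in amul X a](scale0r (0 : A)) -ascalerAl scale0r. Qed.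

Lemma amulr0 a : amul a 0 = 0.
Proof. by rewrite -[X in amul a X](scale0r (0 : A)) -ascalerAr scale0r. Qed.

Lemma amul_suml I (s : seq I) (x : I -> A) a :
  amul (\sum_(i <- s) x i) a = \sum_(i <- s) amul (x i) a.
Proof.
apply: (big_morph (fun y => amul y a)) => [y z|]; [exact: amulDl|exact: amul0r].
Qed.

Lemma amul_sumr I (s : seq I) (x : I -> A) a :
  amul a (\sum_(i <- s) x i) = \sum_(i <- s) amul a (x i).
Proof.
apply: (big_morph (amul a)) => [y z|]; [exact: amulDr|exact: amulr0].
Qed.

End AssocAlgTheory.

Lemma sum_pair (U V : nmodType) I (s : seq I) (x : I -> U) (y : I -> V) :
  \sum_(i <- s) (x i, y i) = (\sum_(i <- s) x i, \sum_(i <- s) y i).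
Proof. by elim: s => [|i s IH]; rewrite ?big_nil // !big_cons IH. Qed.

Lemma linear_map0 (F : fieldType) (U V : lmodType F) (f : U -> V) :
  linear f -> f 0 = 0.
Proof.
by move=> fl; have := fl (-1) 0 0; rewrite scaler0 addr0 scaleN1r addNr.
Qed.

Section GradingTheory.
Variables (F : fieldType) (G : groupType) (A : assocAlgType F).
Variable Gam : grading G A.

Lemma homogN g a : homog Gam g a -> homog Gam g (- a).
Proof. by move=> ag; rewrite -scaleN1r; apply: homogZ. Qed.

Lemma homog_unique g h (a : A) :
  homog Gam g a -> homog Gam h a -> a <> 0 -> g = h.
Proof.
move=> ag ah a0; apply: contrapT => /eqP gh; apply: a0.
pose x k := if k == g then a else if k == h then - a else 0.
have xh k : homog Gam k (x k).
  rewrite /x; case: eqP => [->//|_]; case: eqP => [->|_]; last exact: homog0.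
  exact: homogN.
have <- : x g = a by rewrite /x eqxx.
apply: (@homog_free _ _ _ Gam [:: g; h] x) => //.
- by rewrite /= inE gh.
- by rewrite !big_cons big_nil /x eqxx eq_sym (negPf gh) eqxx addr0 subrr.
- by rewrite inE eqxx.
Qed.

(** Components beyond the given finite set of degrees may be taken to vanish, so
    that any larger set of degrees serves as well; this lets several elements be
    decomposed over one common set. *)
Lemma homog_decomp a : exists (s : seq G) (x : G -> A),
  (forall g, homog Gam g (x g)) /\
  (forall t, uniq t -> {subset s <= t} -> a = \sum_(g <- t) x g).
Proof.
have [s [x [us xh ->]]] := homog_span Gam a.
exists s, (fun g => if g \in s then x g else (0 : A)); split=> [g|t ut st].
  by case: ifP => // _; apply: homog0.
rewrite -big_mkcond -big_filter; apply: perm_big.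
apply: uniq_perm; rewrite ?filter_uniq // => g.
by rewrite mem_filter; case gs: (g \in s) => //; rewrite st.
Qed.

Lemma exists_homog_neq0 (a : A) : a <> 0 ->
  exists g (b : A), homog Gam g b /\ b <> 0.
Proof.
have [s [x [_ xh ->]]] := homog_span Gam a => nz.
apply: contrapT => none; apply: nz; apply: big1_seq => g _.
by apply: contrapT => xg; apply: none; exists g, (x g).
Qed.

End GradingTheory.

Section UnitHomogeneous.
Variables (F : fieldType) (G : groupType) (A : unitalAssocAlgType F).
Variable Gam : grading G A.

(** Write [e] for the component of the unit in degree 1. If [a] is homogeneous,
    comparing the components of both sides of [a = aone a] in the degree of [a]
    gives [a = e a]. By linearity this holds for every [a], in particular for
    the unit, which is therefore equal to [e]. *)
Lemma homog_aone : homog Gam 1%g (aone : A).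
Proof.
have [s0 [x [xh xE]]] := homog_decomp Gam (aone : A).
pose s := undup (1%g :: s0).
have us : uniq s by apply: undup_uniq.
have s1 : 1%g \in s by rewrite mem_undup mem_head.
have sE : aone = \sum_(g <- s) x g.
  by apply: xE => // g gs; rewrite mem_undup inE gs orbT.
have homogE h a : homog Gam h a -> amul (x 1%g) a = a.
  move=> ah.
  (* The component in degree [k] of the difference [aone a - a], which is 0. *)
  pose y k := amul (x (k / h)%g) a - (if k == h then a else 0).
  have yh k : homog Gam k (y k).
    apply: homogD.
      by rewrite -[k in homog _ k](divgK h); apply: homogM.
    apply: homogN; case: eqP => [->//|_]; exact: homog0.
  apply/eqP; rewrite -subr_eq0; apply/eqP.
  have -> : amul (x 1%g) a - a = y h by rewrite /y divgg eqxx.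
  have inj : injective (fun g : G => g * h)%g by apply: mulIg.
  apply: (@homog_free _ _ _ Gam [seq (g * h)%g | g <- s]) => //.
  - by rewrite map_inj_uniq.
  - rewrite big_map /y sumrB; apply/eqP; rewrite subr_eq0; apply/eqP.
    under eq_bigr do rewrite mulgK.
    rewrite -amul_suml -sE amul1r (bigD1_seq 1%g) //= mul1g eqxx.
    rewrite big1 ?addr0 // => g g1; case: eqP => // gh.
    by case/eqP: g1; apply: inj; rewrite mul1g.
  - by apply/mapP; exists 1%g; rewrite ?mul1g.
suff <- : x 1%g = aone by apply: xh.
rewrite -[LHS]amulr1; have [t [z [_ zh ->]]] := homog_span Gam (aone : A).
by rewrite amul_sumr; apply: eq_bigr => g _; apply: (homogE g).
Qed.

End UnitHomogeneous.

(** * Products of algebras *)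

Section ProductAlgebra.
Variables (F : fieldType) (A B : assocAlgType F).

Definition pair_amul (a b : A * B) : A * B := (amul a.1 b.1, amul a.2 b.2).

Fact pair_amulA : associative pair_amul.
Proof. by move=> a b c; rewrite /pair_amul !amulA. Qed.

Fact pair_amulDl : left_distributive pair_amul +%R.
Proof. by move=> a b c; rewrite /pair_amul !amulDl. Qed.

Fact pair_amulDr : right_distributive pair_amul +%R.
Proof. by move=> a b c; rewrite /pair_amul !amulDr. Qed.

Fact pair_ascalerAl (k : F) a b : k *: pair_amul a b = pair_amul (k *: a) b.
Proof. by rewrite /pair_amul /= -!ascalerAl. Qed.

Fact pair_ascalerAr (k : F) a b : k *: pair_amul a b = pair_amul a (k *: b).
Proof. by rewrite /pair_amul /= -!ascalerAr. Qed.

HB.instance Definition _ := Lmodule_isAssocAlg.Build F (A * B)%type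
  pair_amulA pair_amulDl pair_amulDr pair_ascalerAl pair_ascalerAr.

End ProductAlgebra.

Section ProductUnitalAlgebra.
Variables (F : fieldType) (A B : unitalAssocAlgType F).

Fact pair_amul1r : left_id ((aone, aone) : A * B) (@amul F _).
Proof. by case=> a b; congr pair; apply: amul1r. Qed.

Fact pair_amulr1 : right_id ((aone, aone) : A * B) (@amul F _).
Proof. by case=> a b; congr pair; apply: amulr1. Qed.

HB.instance Definition _ :=
  AssocAlg_isUnital.Build F (A * B)%type pair_amul1r pair_amulr1.

End ProductUnitalAlgebra.

Section ProductGrading.
Variables (F : fieldType) (G : groupType) (A B : assocAlgType F).
Variables (GA : grading G A) (GB : grading G B).

Definition pair_homog g (a : A * B) := homog GA g a.1 /\ homog GB g a.2.

Fact pair_homog_span (a : A * B) : exists (s : seq G) (x : G -> A * B),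
  [/\ uniq s, forall g, pair_homog g (x g) & a = \sum_(g <- s) x g].
Proof.
case: a => a b.
have [s [x [xh xE]]] := homog_decomp GA a.
have [t [y [yh yE]]] := homog_decomp GB b.
exists (undup (s ++ t)), (fun g => (x g, y g)); split=> //.
  exact: undup_uniq.
rewrite sum_pair -xE -?yE ?undup_uniq // => g gst;
  by rewrite mem_undup mem_cat gst ?orbT.
Qed.

Fact pair_homog_free (s : seq G) (x : G -> A * B) :
  uniq s -> (forall g, pair_homog g (x g)) -> \sum_(g <- s) x g = 0 ->
  forall g, g \in s -> x g = 0.
Proof.
move=> us xh; under eq_bigr do rewrite [x _]surjective_pairing.
rewrite sum_pair => -[x1 x2] g gs; rewrite [x g]surjective_pairing.
rewrite (homog_free us (fun g => (xh g).1) x1 gs).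
by rewrite (homog_free us (fun g => (xh g).2) x2 gs).
Qed.

Definition pair_grading : grading G (A * B)%type.
Proof.
apply: (@Grading _ _ _ pair_homog) => [g|g a b|g k a| |s x|g h a b].
- by split; apply: homog0.
- by move=> [? ?] [? ?]; split; apply: homogD.
- by move=> [? ?]; split; apply: homogZ.
- exact: pair_homog_span.
- exact: pair_homog_free.
- by move=> [? ?] [? ?]; split; apply: homogM.
Defined.

End ProductGrading.

Section ConcentratedGrading.
Variables (F : fieldType) (G : groupType) (A : assocAlgType F).

(** Degree 1 is the only one compatible with the multiplication of every algebra. *)
Definition concentrated_homog (g : G) (a : A) := g = 1%g \/ a = 0.

Fact concentrated_homog_free (s : seq G) (x : G -> A) :
  uniq s -> (forall g, concentrated_homog g (x g)) ->
  \sum_(g <- s) x g = 0 -> forall g, g \in s -> x g = 0.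
Proof.
move=> us xh s0 g gs; have [g1|//] := xh g.
move: s0; rewrite (bigD1_seq g) //= big1 ?addr0 // => h hg.
by have [h1|//] := xh h; move: hg; rewrite h1 g1 eqxx.
Qed.

Definition concentrated_grading : grading G A.
Proof.
apply: (@Grading _ _ _ concentrated_homog) => [g|g a b|g k a|a|s x|g h a b].
- by right.
- by move=> [->|->]; [left|move=> [->|->]; [left|right; rewrite addr0]].
- by move=> [->|->]; [left|right; rewrite scaler0].
- exists [:: 1%g], (fun g => if g == 1%g then a else 0).
  split=> // [g|]; last by rewrite big_seq1 eqxx.
  by case: eqP => [->|_]; [left|right].
- exact: concentrated_homog_free.
- move=> [->|->] [->|->]; rewrite ?amul0r ?amulr0; try by right.
  by left; rewrite mulg1.
Defined.

End ConcentratedGrading.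

(** * Products of trivially graded algebras and products with zero *)

Section CategoryProducts.
Variable C : category.

Definition terminal (A : C) : Prop :=
  forall X : C, exists! f : Defs.hom X A, True.

Lemma has_product_sym (A B : C) : has_product A B -> has_product B A.
Proof.
move=> [P [pA [pB prod]]]; exists P, pB, pA => X f g.
have [h [[hf hg] hu]] := prod X g f; exists h; split=> // h' [? ?].
exact: hu.
Qed.

Lemma has_product_terminal (A B : C) : terminal A -> has_product A B.
Proof.
move=> tA; have [u _] := tA B; exists B, u, (idm B) => X f g.
exists g; split=> [|h [_ <-]]; last by rewrite comp1m.
have [k [_ ku]] := tA X; split; last exact: comp1m.
by rewrite -(ku f) // -(ku (compm u g)).
Qed.

End CategoryProducts.

Section TrivialProducts.
Variable F : fieldType.

(** The degree need not be 1 when the algebra is not unital, and is arbitrary for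
    the zero algebra, whose support is empty. *)
Lemma trivial_homog (A : grAlg F) : trivial_grading A ->
  exists g, forall a, homog (gr_grading A) g a.
Proof.
move=> tA.
have [[a /exists_homog_neq0-/(_ _ (gr_grading A)) [g [b [bg b0]]]]|none] :=
    pselect (exists a : A, a <> 0).
  exists g => c; have [s [x [_ xh ->]]] := homog_span (gr_grading A) c.
  elim/big_ind: _ => [|y z|h _]; [exact: homog0|exact: homogD|].
  have [->|xn] := pselect (x h = 0); first exact: homog0.
  by rewrite (tA g h) //; [exists b|exists (x h)].
exists 1%g => a; have [->|a0] := pselect (a = 0); first exact: homog0.
by case: none; exists a.
Qed.

Lemma graded_map_trivial (X A : grAlg F) (f : X -> A) :
  trivial_grading A -> @graded_map F X A f.
Proof. by move=> /trivial_homog[h hA] g; exists h => a _; apply: hA. Qed.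

Definition trivial_prod (A B : grAlg F) : grAlg F :=
  GrAlg (concentrated_grading (gr_group A) (A * B)%type).

Lemma trivial_prodP (A B : grAlg F) : trivial_grading (trivial_prod A B).
Proof.
move=> g h [a [ga a0]] [b [hb b0]].
by case: ga => [->|//]; case: hb => [->|//].
Qed.

Lemma graded_hom_fst (A B : grAlg F) :
  trivial_grading A -> @graded_hom F (trivial_prod A B) A fst.
Proof. by move=> tA; split=> //; apply: graded_map_trivial. Qed.

Lemma graded_hom_snd (A B : grAlg F) :
  trivial_grading B -> @graded_hom F (trivial_prod A B) B snd.
Proof. by move=> tB; split=> //; apply: graded_map_trivial. Qed.

Lemma graded_hom_pair (X A B : grAlg F) (f : X -> A) (g : X -> B) :
  @graded_hom F X A f -> @graded_hom F X B g ->
  @graded_hom F X (trivial_prod A B) (fun x => (f x, g x)).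
Proof.
move=> [fl fM _] [gl gM _]; split.
- by move=> k a b; rewrite fl gl.
- by move=> a b; rewrite fM gM.
- exact/graded_map_trivial/trivial_prodP.
Qed.

Lemma graded_hom_zero (X A : grAlg F) : @graded_hom F X A (fun=> 0).
Proof.
split=> [k a b|a b|g]; first by rewrite scaler0 addr0.
- by rewrite amul0r.
- by exists 1%g => a _; apply: homog0.
Qed.

Lemma GrAlg_zero_terminal (A : GrAlg_cat F) : zero_algebra A -> terminal A.
Proof.
move=> zA X; exists (exist _ _ (graded_hom_zero X A)); split=> // -[f fP] _.
by apply: eq_exist; apply: funext => x; rewrite [RHS]zA.
Qed.

Lemma GrAlg1_zero_terminal (A : GrAlg1_cat F) :
  zero_algebra (A : grAlg1 F) -> terminal A.
Proof.
move=> zA X.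
have hX : @unital_graded_hom F X A (fun=> 0).
  by split; [apply: graded_hom_zero|rewrite [RHS]zA].
exists (exist _ _ hX); split=> // -[f fP] _.
by apply: eq_exist; apply: funext => x; rewrite [RHS]zA.
Qed.

Lemma GrAlg_has_product_trivial (A B : grAlg F) :
  trivial_grading A -> trivial_grading B -> @has_product (GrAlg_cat F) A B.
Proof.
move=> tA tB; exists (trivial_prod A B : GrAlg_cat F).
exists (exist _ _ (graded_hom_fst B tA)), (exist _ _ (graded_hom_snd A tB)).
move=> X [f fP] [g gP]; exists (exist _ _ (graded_hom_pair fP gP)).
split; first by split; apply: eq_exist.
move=> [h hP] [[hf] [hg]]; apply: eq_exist; apply: funext => x.
by rewrite -hf -hg /= -surjective_pairing.
Qed.

Lemma GrAlg1_has_product_trivial (A B : grAlg1 F) :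
  trivial_grading A -> trivial_grading B -> @has_product (GrAlg1_cat F) A B.
Proof.
move=> tA tB.
pose P := GrAlg1 (concentrated_grading (gr1_group A)
                    ((A : unitalAssocAlgType F) * (B : unitalAssocAlgType F))%type).
have fP : @unital_graded_hom F P A fst.
  by split=> //; apply: (graded_hom_fst B tA).
have sP : @unital_graded_hom F P B snd.
  by split=> //; apply: (graded_hom_snd A tB).
exists (P : GrAlg1_cat F), (exist _ _ fP), (exist _ _ sP) =>
  X [f [fh f1]] [g [gh g1]].
have pP : @unital_graded_hom F X P (fun x => (f x, g x)).
  by split; [apply: (graded_hom_pair fh gh)|rewrite f1 g1].
exists (exist _ _ pP); split; first by split; apply: eq_exist.
move=> [h hP] [[hf] [hg]]; apply: eq_exist; apply: funext => x.
by rewrite -hf -hg /= -surjective_pairing.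
Qed.

End TrivialProducts.

(** * The test algebra and its evaluation maps *)

(** A polynomial [p] stands for ['X * p], so that all of [{poly F}] encodes the
    ideal generated by ['X], with the product transported from it. *)
Definition xpoly (F : fieldType) := {poly F}.

Notation degree := (Algebra.to_multiplicative int).

Section XPoly.
Variable F : fieldType.

HB.instance Definition _ := GRing.Lmodule.copy (xpoly F) {poly F}.

Definition xpoly_amul (p q : xpoly F) : xpoly F := 'X * (p : {poly F}) * q.

Fact xpoly_amulA : associative xpoly_amul.
Proof. by move=> p q r; rewrite /xpoly_amul !mulrA (mulrAC 'X p). Qed.

Fact xpoly_amulDl : left_distributive xpoly_amul +%R.
Proof. by move=> p q r; rewrite /xpoly_amul [X in X * _]mulrDr mulrDl. Qed.

Fact xpoly_amulDr : right_distributive xpoly_amul +%R.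
Proof. by move=> p q r; rewrite /xpoly_amul [LHS]mulrDr. Qed.

Fact xpoly_ascalerAl (k : F) p q : k *: xpoly_amul p q = xpoly_amul (k *: p) q.
Proof. by rewrite /xpoly_amul [LHS]scalerAl [in LHS]scalerAr. Qed.

Fact xpoly_ascalerAr (k : F) p q : k *: xpoly_amul p q = xpoly_amul p (k *: q).
Proof. by rewrite /xpoly_amul [LHS]scalerAr. Qed.

HB.instance Definition _ := Lmodule_isAssocAlg.Build F (xpoly F)
  xpoly_amulA xpoly_amulDl xpoly_amulDr xpoly_ascalerAl xpoly_ascalerAr.

(** Because of the encoding, the coefficient [p`_i] sits in degree [i + 1]. *)
Definition xpoly_homog (n : degree) (p : xpoly F) :=
  forall i, n != i.+1%:Z -> (p : {poly F})`_i = 0.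

Fact xpoly_homog_span (p : xpoly F) : exists (s : seq degree) (x : degree -> xpoly F),
  [/\ uniq s, forall n, xpoly_homog n (x n) & p = \sum_(n <- s) x n].
Proof.
pose x (n : degree) : xpoly F :=
  if (n : int) is Posz i.+1 then (p : {poly F})`_i *: 'X^i else 0.
exists [seq (i.+1%:Z : degree) | i <- iota 0 (size (p : {poly F}))], x; split.
- by rewrite map_inj_uniq ?iota_uniq // => i j [].
- case=> [[|j]|j] i /=; rewrite ?coef0 // => ij.
  by rewrite coefZ coefXn; case: (eqVneq i j) ij => [->|_ _]; rewrite ?eqxx ?mulr0.
- rewrite big_map -{1}[LHS](coefK (p : {poly F})) poly_def.
  by rewrite -[size p in RHS]subn0 big_mkord.
Qed.

Fact xpoly_homog_free (s : seq degree) (x : degree -> xpoly F) :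
  uniq s -> (forall n, xpoly_homog n (x n)) ->
  \sum_(n <- s) x n = 0 -> forall n, n \in s -> x n = 0.
Proof.
move=> us xh s0 n ns; apply/polyP => i; rewrite coef0.
have [ni|/xh//] := eqVneq n (i.+1%:Z : degree).
have := congr1 (fun p : {poly F} => p`_i) s0; rewrite /= coef0 coef_sum.
rewrite (bigD1_seq n) //= big1 ?addr0 // => m mn.
by apply: xh; rewrite -ni.
Qed.

Fact xpoly_homogM (m n : degree) p q :
  xpoly_homog m p -> xpoly_homog n q -> xpoly_homog (m * n)%g (amul p q).
Proof.
have -> : amul p q = (p : {poly F}) * q * 'X :> {poly F}.
  by rewrite mulrC mulrA.
move=> mp nq [|i] mn; rewrite coefMX //= coefM.
apply: big1 => j _.
have [mj|/mp->] := eqVneq m (j.+1%:Z : degree); last by rewrite mul0r.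
have [nj|/nq->] := eqVneq n ((i - j).+1%:Z : degree); last by rewrite mulr0.
case/eqP: mn; rewrite mj nj; change (j.+1%:Z + (i - j).+1%:Z = i.+2%:Z).
by rewrite -PoszD addSn addnS subnKC // -ltnS.
Qed.

Definition xpoly_grading : grading degree (xpoly F).
Proof.
apply: (@Grading _ _ _ xpoly_homog) => [n i|n p q hp hq i ni|n k p hp i ni||s x|].
- by rewrite coef0.
- by rewrite coefD hp // hq // addr0.
- by rewrite coefZ hp // mulr0.
- exact: xpoly_homog_span.
- exact: xpoly_homog_free.
- exact: xpoly_homogM.
Defined.

(** The algebra [xF[x] * yF[y]] with both generators in degree 1. *)
Definition test_alg : grAlg F :=
  GrAlg (pair_grading xpoly_grading xpoly_grading).

(** This is what makes [test_alg] accessible to the unital category; see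
    [unital_extension_graded]. The neutral element of [degree] is 0. *)
Lemma test_alg_degree0 (t : test_alg) :
  homog (gr_grading test_alg) 1%g t -> t = 0.
Proof.
case: t => p q [/= hp hq].
by congr pair; apply/polyP => i; rewrite coef0; [apply: hp|apply: hq].
Qed.

(** The constant 1 encodes the generator ['X]. *)
Lemma test_alg_generators :
  homog (gr_grading test_alg) (1%:Z : degree) (1, 0) /\
  homog (gr_grading test_alg) (1%:Z : degree) (0, 1).
Proof.
by split; split=> -[|i] //= _; rewrite ?coef0 ?coef1.
Qed.

Lemma graded_hom_test_snd :
  @graded_hom F test_alg test_alg (fun t => (0, t.2)).
Proof.
split.
- by move=> k [a b] [c d]; congr pair; rewrite /= scaler0 addr0.
- by move=> [a b] [c d]; congr pair; rewrite /= amul0r.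
- by move=> n; exists n => -[a b] [ha hb]; split => //; apply: homog0.
Qed.

End XPoly.

(** The value at [a] of the polynomial ['X * p]. *)
Definition xeval (F : fieldType) (A : assocAlgType F) (a : A) (p : xpoly F) : A :=
  \sum_(i < size (p : {poly F})) (p : {poly F})`_i *: iter i (amul a) a.

Section XEval.
Variables (F : fieldType) (A : assocAlgType F) (a : A).
Implicit Types p q : {poly F}.

(** A common summation bound for several polynomials. *)
Lemma xevalE n p : (size p <= n)%N ->
  xeval a p = \sum_(i < n) p`_i *: iter i (amul a) a.
Proof.
move=> pn; rewrite /xeval (big_ord_widen n (fun i => p`_i *: iter i (amul a) a)) //.
rewrite big_mkcond; apply: eq_bigr => i _; case: ltnP => // pi.
by rewrite nth_default // scale0r.
Qed.

Lemma xeval_linear : linear (xeval a).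
Proof.
move=> k p q; set r : {poly F} := k *: p + q.
pose n := maxn (size r) (maxn (size (p : {poly F})) (size (q : {poly F}))).
rewrite !(@xevalE n) ?leq_max ?leqnn ?orbT //.
rewrite scaler_sumr -big_split; apply: eq_bigr => i _ /=.
by rewrite coefD coefZ scalerDl scalerA.
Qed.

Lemma xevalD p q : xeval a (p + q) = xeval a p + xeval a q.
Proof. by have := xeval_linear 1 p q; rewrite !scale1r. Qed.

Lemma xeval0 : xeval a 0 = 0.
Proof. by rewrite (@xevalE 0) ?big_ord0 // size_poly0. Qed.

Lemma xevalZ k p : xeval a (k *: p) = k *: xeval a p.
Proof. by have := xeval_linear k p 0; rewrite xeval0 !addr0. Qed.

Lemma xeval1 : xeval a 1 = a.
Proof. by rewrite (@xevalE 1) ?size_poly1 // big_ord1 coef1 scale1r. Qed.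

Lemma xeval_mulX p : xeval a (p * 'X) = amul a (xeval a p).
Proof.
rewrite (@xevalE (size p).+1) ?(leq_trans (size_polyMleq _ _)) ?size_polyX ?addn2 //.
rewrite big_ord_recl coefMX scale0r add0r /xeval amul_sumr.
by apply: eq_bigr => i _; rewrite coefMX -ascalerAr.
Qed.

Lemma xevalM : {morph xeval a : p q / amul p q}.
Proof.
move=> p q; change (xeval a ('X * (p : {poly F}) * q) = amul (xeval a p) (xeval a q)).
elim/poly_ind: (p : {poly F}) => [|r c IH].
  by rewrite mulr0 mul0r !xeval0 amul0r.
have -> : 'X * (r * 'X + c%:P) * (q : {poly F}) =
    'X * r * q * 'X + c *: (q * 'X) :> {poly F}.
  rewrite -mul_polyC mulrDr mulrDl !mulrA; congr (_ + _).
    by rewrite mulrAC.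
  by rewrite -!mulrA mulrCA; congr (_ * _); rewrite mulrC.
rewrite [LHS]xevalD xevalZ !xeval_mulX IH.
rewrite [in RHS]xevalD xeval_mulX -alg_polyC xevalZ xeval1.
by rewrite amulDl amulA -ascalerAl.
Qed.

End XEval.

Lemma xeval_homog (F : fieldType) (A : grAlg F) g (a : A) (n : degree) :
  homog (gr_grading A) g a -> exists h, forall p : xpoly F,
  xpoly_homog n p -> homog (gr_grading A) h (xeval a p).
Proof.
move=> ga.
have iterP i : homog (gr_grading A) (iter i (fun k => g * k)%g g) (iter i (amul a) a).
  by elim: i => //= i; apply: homogM.
have [[i ni]|none] := pselect (exists i, n = (i.+1%:Z : degree)).
  exists (iter i (fun k => g * k)%g g) => p np; rewrite /xeval.
  elim/big_ind: _ => [|x y|j _]; [exact: homog0|exact: homogD|].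
  have [<-|ij] := eqVneq i (j : nat); first exact/homogZ/iterP.
  rewrite np ?scale0r; first exact: homog0.
  by rewrite ni; apply: contra_neq ij => -[].
exists 1%g => p np; suff -> : p = 0 by rewrite xeval0; apply: homog0.
apply/polyP => i; rewrite coef0 np //; apply/eqP => ni.
by apply: none; exists i.
Qed.

Section TestMaps.
Variables (F : fieldType) (A : grAlg F) (g : gr_group A) (a : A).
Hypothesis ga : homog (gr_grading A) g a.

Lemma graded_hom_xeval_fst :
  @graded_hom F (test_alg F) A (fun t => xeval a t.1).
Proof.
split=> [k t u|t u|n]; [exact: xeval_linear|exact: xevalM|].
by have [h hP] := xeval_homog n ga; exists h => t [? _]; apply: hP.
Qed.

Lemma graded_hom_xeval_snd :
  @graded_hom F (test_alg F) A (fun t => xeval a t.2).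
Proof.
split=> [k t u|t u|n]; [exact: xeval_linear|exact: xevalM|].
by have [h hP] := xeval_homog n ga; exists h => t [_ ?]; apply: hP.
Qed.

End TestMaps.

(** * Products force trivial gradings *)

Section ProductOn.
Variable F : fieldType.

(** Phrased with bare functions and a single source [X], so that it can be derived
    from products in either of the two categories. *)
Definition product_on (X A B P : grAlg F) (pA : P -> A) (pB : P -> B) : Prop :=
  forall (f : X -> A) (g : X -> B), @graded_hom F X A f -> @graded_hom F X B g ->
  exists h : X -> P, [/\ @graded_hom F X P h, pA \o h = f, pB \o h = g &
    forall h', @graded_hom F X P h' -> pA \o h' = f -> pB \o h' = g -> h' = h].

Lemma product_on_sym (X A B P : grAlg F) (pA : P -> A) (pB : P -> B) :
  product_on X pA pB -> product_on X pB pA.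
Proof.
move=> prod f g fh gh; have [h [hh hf hg hu]] := prod g f gh fh.
by exists h; split=> // h' ? ? ?; apply: hu.
Qed.

(** For a homogeneous [a], the lift of [x |-> a, y |-> 0] and [x |-> 0, y |-> b]
    sends [y] to a nonzero element of [P] that does not depend on [a]; its
    component therefore contains the images of [x] for all [a]. *)
Lemma product_on_trivial (A B P : grAlg F) (pA : P -> A) (pB : P -> B) :
  @graded_hom F P A pA -> @graded_hom F P B pB ->
  product_on (test_alg F) pA pB -> ~ zero_algebra B -> trivial_grading A.
Proof.
move=> [_ _ pAG] [pBl _ _] prod nzB.
have [k [b [bk b0]]] : exists k b, homog (gr_grading B) k b /\ b <> 0.
  by have /existsNP[b /(exists_homog_neq0 (gr_grading B))] := nzB.
have [gen1 gen2] := test_alg_generators F.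
have b2 := graded_hom_xeval_snd bk.
(* The lift at [a = 0]; its value at [y] is the element common to all lifts. *)
have [k0 [_ _ k0B k0u]] := prod _ _ (graded_hom_zero _ _) b2.
have sndh := graded_hom_test_snd F.
have lift g (a : A) : homog (gr_grading A) g a -> a <> 0 -> exists2 p,
    homog (gr_grading P) p (k0 (0, 1)) &
    exists2 u, homog (gr_grading P) p u & pA u = a.
  move=> ag a0.
  have [h [hh hA hB _]] := prod _ _ (graded_hom_xeval_fst ag) b2.
  have [p hp] : exists p, forall t, homog (gr_grading (test_alg F)) (1%:Z : degree) t ->
      homog (gr_grading P) p (h t) by case: hh.
  exists p; last first.
    exists (h (1, 0)); first exact: hp.
    by rewrite -[LHS]/((pA \o h) _) hA /= xeval1.
  rewrite -(k0u (h \o (fun t => (0, t.2)))); first exact: hp.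
  - exact: (graded_hom_comp (g := fun t : test_alg F => (0, t.2) : test_alg F) hh sndh).
  - by rewrite compA hA; apply: funext => t /=; rewrite xeval0.
  - by rewrite compA hB.
have v0 : k0 (0, 1) <> 0.
  move=> v0; apply: b0; rewrite -[RHS](linear_map0 pBl) -v0.
  by rewrite -[RHS]/((pB \o k0) _) k0B /= xeval1.
move=> g h [a [ag a0]] [c [ch c0]].
have [p pv [u pu uE]] := lift g a ag a0.
have [q qv [w qw wE]] := lift h c ch c0.
have [r rP] := pAG p.
have qp := homog_unique qv pv v0; rewrite {}qp in qw.
have ar : homog (gr_grading A) r a by rewrite -uE; apply: rP.
have cr : homog (gr_grading A) r c by rewrite -wE; apply: rP.
by rewrite (homog_unique ag ar a0) (homog_unique ch cr c0).
Qed.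

End ProductOn.

(** * Unitization *)

(** The pair [(c, a)] stands for [c + a]. *)
Definition unitization (F : fieldType) (A : assocAlgType F) : Type := (F^o * A)%type.

Section Unitization.
Variables (F : fieldType) (A : assocAlgType F).

HB.instance Definition _ := GRing.Lmodule.copy (unitization A) (F^o * A)%type.

Definition unitization_amul (x y : unitization A) : unitization A :=
  (x.1 * y.1, (x.1 : F) *: y.2 + (y.1 : F) *: x.2 + amul x.2 y.2).

Fact unitization_amulA : associative unitization_amul.
Proof.
move=> [c a] [d b] [e z]; congr pair => /=; first exact: mulrA.
rewrite !scalerDr !scalerA !amulDl !amulDr -!ascalerAl -!ascalerAr amulA.
rewrite (mulrC e c) (mulrC e d) [LHS](AC (3*1*3) (1*(2*4*6)*(3*5*7))).
by [].
Qed.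

Fact unitization_amulDl : left_distributive unitization_amul +%R.
Proof.
move=> [c a] [d b] [e z]; congr pair => /=; first exact: mulrDl.
by rewrite scalerDl scalerDr amulDl [LHS](AC (2*2*2) ((1*3*5)*(2*4*6))).
Qed.

Fact unitization_amulDr : right_distributive unitization_amul +%R.
Proof.
move=> [c a] [d b] [e z]; congr pair => /=; first exact: mulrDr.
by rewrite scalerDl scalerDr amulDr [LHS](AC (2*2*2) ((1*3*5)*(2*4*6))).
Qed.

Fact unitization_ascalerAl (k : F) x y :
  k *: unitization_amul x y = unitization_amul (k *: x) y.
Proof.
case: x y => [c a] [d b]; rewrite /unitization_amul.
congr pair => /=; first exact: mulrA.
rewrite !scalerDr -ascalerAl !scalerA.
by rewrite (mulrC k d).
Qed.

Fact unitization_ascalerAr (k : F) x y :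
  k *: unitization_amul x y = unitization_amul x (k *: y).
Proof.
case: x y => [c a] [d b]; rewrite /unitization_amul.
congr pair => /=; first exact: mulrCA.
rewrite !scalerDr -ascalerAr !scalerA.
by rewrite (mulrC k c).
Qed.

HB.instance Definition _ := Lmodule_isAssocAlg.Build F (unitization A)
  unitization_amulA unitization_amulDl unitization_amulDr
  unitization_ascalerAl unitization_ascalerAr.

Fact unitization_amul1r : left_id ((1, 0) : unitization A) (@amul F _).
Proof.
case=> c a; rewrite /amul /= /unitization_amul /= mul1r scale1r scaler0.
by rewrite amul0r !addr0.
Qed.

Fact unitization_amulr1 : right_id ((1, 0) : unitization A) (@amul F _).
Proof.
case=> c a; rewrite /amul /= /unitization_amul /= mulr1 scale1r scaler0.
by rewrite amulr0 add0r addr0.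
Qed.

HB.instance Definition _ := AssocAlg_isUnital.Build F (unitization A)
  unitization_amul1r unitization_amulr1.

End Unitization.

Section UnitizationGrading.
Variables (F : fieldType) (X : grAlg F).

Fact regular_ascalerAl (k : F) (c d : F^o) : k *: (c * d) = (k *: c) * d.
Proof. exact: mulrA. Qed.

Fact regular_ascalerAr (k : F) (c d : F^o) : k *: (c * d) = c * (k *: d).
Proof. exact: mulrCA. Qed.

HB.instance Definition _ := Lmodule_isAssocAlg.Build F F^o
  (@mulrA F) (@mulrDl F) (@mulrDr F) regular_ascalerAl regular_ascalerAr.

Notation G := (gr_group X).

(** As a graded vector space, the unitization is the direct product of [X] and
    of [F] in degree 1. *)
Definition unitization_pair_grading : grading G (F^o * X)%type :=
  pair_grading (concentrated_grading G F^o) (gr_grading X).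

Fact unitization_homogM (g h : G) (x y : unitization X) :
  homog unitization_pair_grading g x -> homog unitization_pair_grading h y ->
  homog unitization_pair_grading (g * h)%g (amul x y).
Proof.
case: x y => [c a] [d b] [/= cg ag] [/= dh bh]; split=> /=.
  case: cg => [->|->]; last by right; rewrite mul0r.
  by rewrite mul1g; case: dh => ->; [left|right; rewrite mulr0].
apply: homogD; last exact: homogM.
apply: homogD.
  case: cg => ->; last by rewrite scale0r; apply: homog0.
  by rewrite mul1g; apply: homogZ.
case: dh => ->; last by rewrite scale0r; apply: homog0.
by rewrite mulg1; apply: homogZ.
Qed.

Definition unitization_grading : grading G (unitization X) :=
  @Grading F G (unitization X) (homog unitization_pair_grading)
    (homog0 unitization_pair_grading) (@homogD _ _ _ unitization_pair_grading)
    (@homogZ _ _ _ unitization_pair_grading) (homog_span unitization_pair_grading)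
    (@homog_free _ _ _ unitization_pair_grading) unitization_homogM.

Definition gr_unitization : grAlg1 F := GrAlg1 unitization_grading.

Definition unital_extension (A : grAlg1 F) (f : X -> A) (x : unitization X) : A :=
  (x.1 : F) *: aone + f x.2.

(** The degree 1 component of the unitization has to be mapped into a single
    component of [A], namely that of the unit. Were [X] nonzero in degree 1, its
    elements might be mapped into another component: [f] need not respect the
    neutral elements of the groups. *)
Lemma unital_extension_graded (A : grAlg1 F) (f : X -> A) :
  (forall x, homog (gr_grading X) 1%g x -> x = 0) ->
  @graded_hom F X A f ->
  @unital_graded_hom F gr_unitization A (unital_extension f).
Proof.
move=> X1 [fl fM fG]; have f0 := linear_map0 fl.
have fD a b : f (a + b) = f a + f b by have := fl 1 a b; rewrite !scale1r.
have fZ k a : f (k *: a) = k *: f a by have := fl k a 0; rewrite f0 !addr0.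
split; last by rewrite /unital_extension f0 scale1r addr0.
split.
- move=> k [c a] [d b]; rewrite /unital_extension /= fl scalerDl -scalerA.
  by rewrite scalerDr addrACA.
- move=> [c a] [d b]; rewrite /unital_extension /= !fD !fZ fM.
  rewrite amulDl !amulDr -!ascalerAl -!ascalerAr !amul1r amulr1 scalerA.
  by rewrite !addrA.
- move=> g; have [h fh] := fG g.
  have [->|g1] := eqVneq g 1%g.
    exists 1%g => -[c a] [_ /X1 /= ->]; rewrite /unital_extension f0 addr0.
    by apply/homogZ/homog_aone.
  exists h => -[c a] [/= [gg|->] ag]; first by rewrite gg eqxx in g1.
  by rewrite /unital_extension scale0r add0r; apply: fh.
Qed.

Lemma graded_hom_unitization : @graded_hom F X gr_unitization (fun x => (0, x)).
Proof.
split.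
- by move=> k a b; congr pair; rewrite /= ?scaler0 ?addr0.
- by move=> a b; congr pair; rewrite ?mulr0 // !scale0r !add0r.
- by move=> g; exists g => a ag; split=> //; right.
Qed.

(** If [X] lives in degrees other than 1, maps [X -> A] and unital maps from the
    unitization of [X] to [A] correspond to each other, so a product of unital
    algebras keeps its universal property for [X]. *)
Lemma GrAlg1_product_on (A B P : grAlg1 F) (pA : @GrAlg1_hom F P A)
    (pB : @GrAlg1_hom F P B) :
  (forall x, homog (gr_grading X) 1%g x -> x = 0) ->
  @is_product (GrAlg1_cat F) A B P pA pB ->
  @product_on F X A B P (sval pA) (sval pB).
Proof.
move=> X1 prod f g fh gh.
have [[h hh] [[hA hB] hu]] := prod (gr_unitization : GrAlg1_cat F)
  (exist _ _ (unital_extension_graded X1 fh))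
  (exist _ _ (unital_extension_graded X1 gh)).
have {}hA x : sval pA (h x) = unital_extension f x.
  by have := congr1 (fun k => sval k x) hA.
have {}hB x : sval pB (h x) = unital_extension g x.
  by have := congr1 (fun k => sval k x) hB.
exists (fun x => h (0, x)); split.
- exact: (@graded_hom_comp F X gr_unitization P _ _ (proj1 hh)
             graded_hom_unitization).
- by apply: funext => x; rewrite /= hA /unital_extension scale0r add0r.
- by apply: funext => x; rewrite /= hB /unital_extension scale0r add0r.
- move=> k kh kA kB.
  have ext C (p : @GrAlg1_hom F P C) (l : X -> C) : sval p \o k = l ->
      sval p \o unital_extension k = unital_extension l.
    move=> <-; case: p => p /= [[pl _ _] p1]; apply: funext => x.
    rewrite /unital_extension /=.
    by rewrite pl p1.
  have hk : h = unital_extension k.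
    apply: (congr1 sval (hu (exist _ _ (unital_extension_graded X1 kh)) _)).
    by split; apply: eq_exist; apply: ext.
  by apply: funext => x; rewrite hk /unital_extension scale0r add0r.
Qed.

End UnitizationGrading.

Lemma GrAlg_product_on (F : fieldType) (X A B P : grAlg F) (pA : @GrAlg_hom F P A)
    (pB : @GrAlg_hom F P B) :
  @is_product (GrAlg_cat F) A B P pA pB ->
  @product_on F X A B P (sval pA) (sval pB).
Proof.
move=> prod f g fh gh.
have [[h hh] [[hA hB] hu]] := prod X (exist _ _ fh) (exist _ _ gh).
exists h; split=> // [||k kh kA kB]; [
  exact: (congr1 (fun k => sval k) hA)|exact: (congr1 (fun k => sval k) hB)|].
apply/esym/(congr1 sval (hu (exist _ _ kh) _)).
by split; apply: eq_exist.
Qed.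

Theorem theoremA (F : fieldType) :
    (forall A B : grAlg F,
       @has_product (GrAlg_cat F) A B <->
       ((zero_algebra A \/ zero_algebra B) \/
        (trivial_grading A /\ trivial_grading B))) /\
    (forall A B : grAlg1 F,
       @has_product (GrAlg1_cat F) A B <->
       ((zero_algebra A \/ zero_algebra B) \/
        (trivial_grading A /\ trivial_grading B))).
Proof.
have forward (A B P : grAlg F) (pA : P -> A) (pB : P -> B) :
    @graded_hom F P A pA -> @graded_hom F P B pB -> product_on (test_alg F) pA pB ->
    (zero_algebra A \/ zero_algebra B) \/ (trivial_grading A /\ trivial_grading B).
  move=> pAh pBh prod.
  have [?|nzA] := pselect (zero_algebra A); first by left; left.
  have [?|nzB] := pselect (zero_algebra B); first by left; right.
  right; split; first exact: product_on_trivial prod nzB.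
  exact: product_on_trivial (product_on_sym prod) nzA.
split=> A B; split.
- by move=> [P [pA [pB /GrAlg_product_on prod]]]; apply: forward (prod _);
    apply: svalP.
- case=> [[zA|zB]|[tA tB]]; last exact: GrAlg_has_product_trivial.
    exact/has_product_terminal/GrAlg_zero_terminal.
  exact/has_product_sym/has_product_terminal/GrAlg_zero_terminal.
- move=> [P [pA [pB]]].
  move=> /(GrAlg1_product_on (X := test_alg F) (@test_alg_degree0 F)).
  by apply: forward; [case: pA => ? []|case: pB => ? []].
- case=> [[zA|zB]|[tA tB]]; last exact: GrAlg1_has_product_trivial.
    exact/has_product_terminal/GrAlg1_zero_terminal.
  exact/has_product_sym/has_product_terminal/GrAlg1_zero_terminal.
Qed.
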